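(* Let $B$ be a commutative Banach algebra and let $A$ be a closed ideal in $B$ such that $A\widehat{\otimes}B$ is weakly amenable. Then $A$ is weakly amenable.
   Context: $\widehat{\otimes}$ denotes the projective tensor product; $A\widehat{\otimes}B$ is a Banach algebra with product determined by $(a\otimes b)(c\otimes d)=ac\otimes bd$. For a Banach algebra $C$, the dual $C^*$ is a Banach $C$-bimodule via $\langle a.f,x\rangle=\langle f,xa\rangle$ and $\langle f.a,x\rangle=\langle f,ax\rangle$ for $a,x\in C$, $f\in C^*$. A derivation $D:C\to C^*$ is a linear map with $D(ab)=a.D(b)+D(a).b$ for $a,b\in C$; it is inner if there is $f\in C^*$ with $D(a)=a.f-f.a$ for all $a\in C$. A Banach algebra $C$ is weakly amenable if every continuous derivation from $C$ into $C^*$ is inner. *)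

(* Defs.v *)
From HB Require Import structures.
From mathcomp Require Import all_boot all_order all_algebra.
From mathcomp Require Import complex.
From mathcomp Require Import all_classical all_reals topology normedtype.

Set Implicit Arguments.
Unset Strict Implicit.
Unset Printing Implicit Defensive.

Import Order.TTheory GRing.Theory Num.Theory.
Import numFieldNormedType.Exports.

Local Open Scope classical_set_scope.
Local Open Scope ring_scope.
Local Open Scope complex_scope.

Reserved Notation "x *b y" (at level 40, left associativity).

(* Banach algebras are not assumed to have a unit, so the multiplication cannot
   come from the (unital) ring structures of MathComp. *)
HB.mixin Record CompleteNormedModule_isBanachAlgebra (K : numFieldType) V
    & CompleteNormedModule K V := {
  bmul : V -> V -> V;
  bmulA : associative bmul;
  bmulDl : left_distributive bmul +%R;
  bmulDr : right_distributive bmul +%R;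
  bscaleAl : forall (k : K) (x y : V), k *: bmul x y = bmul (k *: x) y;
  bscaleAr : forall (k : K) (x y : V), k *: bmul x y = bmul x (k *: y);
  ler_norm_bmul : forall x y : V, `|bmul x y| <= `|x| * `|y|
}.

#[short(type="banachAlgType")]
HB.structure Definition BanachAlgebra (K : numFieldType) :=
  {V of CompleteNormedModule K V & CompleteNormedModule_isBanachAlgebra K V}.

Notation "x *b y" := (bmul x y) : ring_scope.

Section RealNorm.
Context {R : realType} {V : normedModType R[i]}.
Implicit Types x y : V.

(* The norm of a complex normed space is an element of R[i] with zero imaginary
   part; this is the same number as an element of R. *)
Definition rnorm x : R := complex.Re `|x|.

Lemma rnormE x : `|x| = (rnorm x)%:C.
Proof.
rewrite /rnorm; have := normr_ge0 x.
by case: `|x| => a b; rewrite lecE /= => /andP[/eqP -> _].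
Qed.

Lemma rnorm_ge0 x : 0 <= rnorm x.
Proof. by have := normr_ge0 x; rewrite rnormE lecR. Qed.

Lemma rnorm0 : rnorm (0 : V) = 0.
Proof. by rewrite /rnorm normr0. Qed.

Lemma rnorm_eq0 x : (rnorm x == 0) = (x == 0).
Proof. by rewrite -(normr_eq0 x) rnormE -(inj_eq (@complexI R)). Qed.

Lemma ler_rnormD x y : rnorm (x + y) <= rnorm x + rnorm y.
Proof. by have := ler_normD x y; rewrite !rnormE -rmorphD lecR. Qed.

Lemma rnormZ (r : R) x : rnorm (r%:C *: x) = `|r| * rnorm x.
Proof.
apply: (@complexI R); rewrite rmorphM -rnormE normrZ normc_def /= expr0n addr0.
by rewrite sqrtr_sqr (rnormE x).
Qed.

End RealNorm.

Lemma rnormM {R : realType} (x y : R[i]^o) :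
  rnorm (x * y : R[i]^o) = rnorm x * rnorm y.
Proof.
apply: (@complexI R); rewrite rmorphM -rnormE.
by rewrite [LHS](normrM (x : R[i]) y) (rnormE (x : R[i]^o)) (rnormE (y : R[i]^o)).
Qed.

Section Dual.
Context {R : realType} {V : normedModType R[i]}.
Local Notation K := R[i].

Definition dual_pred : {pred V -> K^o} :=
  mem [set f : V -> K^o | linear f /\ continuous f].

Record dual := Dual { dual_fun :> V -> K^o; _ : dual_fun \in dual_pred }.

HB.instance Definition _ := [isSub for dual_fun].
HB.instance Definition _ := [Choice of dual by <:].

Lemma dual_linear (f : dual) : linear f.
Proof. by case: f => f /= /set_mem[]. Qed.

Lemma dual_continuous (f : dual) : continuous f.
Proof. by case: f => f /= /set_mem[]. Qed.

Lemma dualP (f g : dual) : f =1 g -> f = g.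
Proof. by move=> fg; apply/val_inj/funext. Qed.

HB.instance Definition _ (f : dual) :=
  GRing.isLinear.Build K V K^o *:%R (dual_fun f) (dual_linear f).

Lemma dual_submod_closed : submod_closed dual_pred.
Proof.
split.
  apply/mem_set; split=> [k x y|]; first by rewrite /= scaler0 addr0.
  exact: cst_continuous.
move=> k f g /set_mem[lf cf] /set_mem[lg cg]; apply/mem_set; split=> [a x y|x].
  rewrite !fctE lf lg !scalerDr !scalerA [a * k]mulrC -!addrA; congr (_ + _).
  by rewrite addrCA.
apply: (@cvgD _ _ _ (nbhs x) _ (k \*: f) g); last exact: cg.
by apply: cvgZl_tmp; exact: cf.
Qed.

HB.instance Definition _ :=
  GRing.isSubmodClosed.Build K (V -> K^o) dual_pred dual_submod_closed.
HB.instance Definition _ := [SubChoice_isSubLmodule of dual by <:].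

Definition opnorm (f : dual) : R :=
  sup [set rnorm (f x) | x in [set x : V | rnorm x <= 1]].

Lemma dual_bounded (f : dual) :
  exists2 M : R, 0 <= M & forall x, rnorm (f x) <= M * rnorm x.
Proof.
have : bounded_near f (nbhs (0 : V)).
  by apply/linear_bounded_continuous; exact: dual_continuous.
move=> /linear_boundedP/pinfty_ex_gt0[M M0 fM].
have {}fM x : `|f x| <= M * `|x| by exact: fM.
have MC := RRe_real (gtr0_real M0).
exists (complex.Re M); first by rewrite -lecR MC ltW.
by move=> x; have := fM x; rewrite !rnormE -MC -rmorphM lecR.
Qed.

Let opnorm_set (f : dual) := [set rnorm (f x) | x in [set x : V | rnorm x <= 1]].

Lemma opnorm_has_sup (f : dual) : has_sup (opnorm_set f).
Proof.
split; first by exists (rnorm (f 0)), 0 => //=; rewrite rnorm0.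
have [M M0 fM] := dual_bounded f; exists M => _ [x /= x1 <-].
by rewrite (le_trans (fM x))// ler_piMr.
Qed.

Lemma opnorm_ge0 (f : dual) : 0 <= opnorm f.
Proof.
apply: (le_trans (rnorm_ge0 (f 0))).
by apply: (sup_upper_bound (opnorm_has_sup f)); exists 0 => //=; rewrite rnorm0.
Qed.

Lemma ler_opnorm (f : dual) x : rnorm (f x) <= opnorm f * rnorm x.
Proof.
have [->|x0] := eqVneq x 0; first by rewrite linear0 !rnorm0 mulr0.
have nx : 0 < rnorm x by rewrite lt_neqAle eq_sym rnorm_eq0 x0 rnorm_ge0.
rewrite -ler_pdivrMr//.
apply: (sup_upper_bound (opnorm_has_sup f)).
exists ((rnorm x)^-1%:C *: x) => /=.
  by rewrite rnormZ ger0_norm ?invr_ge0 ?rnorm_ge0// mulVf ?gt_eqF.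
by rewrite linearZ rnormZ ger0_norm ?invr_ge0 ?rnorm_ge0// mulrC.
Qed.

Lemma opnorm_le (f : dual) (M : R) :
  0 <= M -> (forall x, rnorm (f x) <= M * rnorm x) -> opnorm f <= M.
Proof.
move=> M0 fM; apply: ge_sup; first by have [] := opnorm_has_sup f.
by move=> _ [x /= x1 <-]; rewrite (le_trans (fM x))// ler_piMr.
Qed.

Let dual_norm (f : dual) : K := (opnorm f)%:C.

Let dual_normD (f g : dual) : dual_norm (f + g) <= dual_norm f + dual_norm g.
Proof.
rewrite -[leRHS]rmorphD lecR; apply: opnorm_le.
  by rewrite addr_ge0 ?opnorm_ge0.
move=> x; rewrite (le_trans (ler_rnormD (f x) (g x)))// mulrDl.
by rewrite lerD ?ler_opnorm.
Qed.

Let opnormZ_le (k : K) (f : dual) : opnorm (k *: f) <= rnorm (k : K^o) * opnorm f.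
Proof.
apply: opnorm_le; first by rewrite mulr_ge0 ?opnorm_ge0 ?rnorm_ge0.
move=> x; rewrite [X in X <= _](rnormM k (f x)) -mulrA ler_wpM2l ?rnorm_ge0//.
exact: ler_opnorm.
Qed.

Let dual_normZ (k : K) (f : dual) : dual_norm (k *: f) = `|k| * dual_norm f.
Proof.
rewrite (rnormE (k : K^o)) -rmorphM; congr (_ %:C).
apply/eqP; rewrite eq_le opnormZ_le andTb.
have [->|k0] := eqVneq k 0.
  by rewrite rnorm0 mul0r opnorm_ge0.
have nk : 0 < rnorm (k : K^o) by rewrite lt_neqAle eq_sym rnorm_eq0 k0 rnorm_ge0.
rewrite -ler_pdivlMl//.
have {1}-> : f = k^-1 *: (k *: f) by rewrite scalerA mulVf// scale1r.
rewrite (le_trans (opnormZ_le _ _))// ler_wpM2r ?opnorm_ge0//.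
rewrite -(ler_pM2l nk) divff ?gt_eqF// -rnormM mulfV//.
by rewrite /rnorm normr1.
Qed.

Let dual_norm0_eq0 (f : dual) : dual_norm f = 0 -> f = 0.
Proof.
case=> f0; apply: dualP => x.
have := ler_opnorm f x; rewrite f0 mul0r => fx0.
by apply/eqP; rewrite -rnorm_eq0 eq_le fx0 rnorm_ge0.
Qed.

HB.instance Definition _ :=
  Lmodule_isNormed.Build K dual dual_normD dual_normZ dual_norm0_eq0.

Lemma dual_normE (f : dual) : `|f| = (opnorm f)%:C.
Proof. by []. Qed.

End Dual.
Arguments dual {R} V.

Section DualBimodule.
Context {R : realType} {C : banachAlgType R[i]}.
Implicit Types (a x : C) (f : dual C).

Let bmul_continuous (h : C -> C) a : linear h ->
  (forall x, `|h x| <= `|a| * `|x|) -> continuous h.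
Proof.
move=> lh hb; pose H := GRing.isLinear.Build R[i] C C *:%R h lh.
pose hl : {linear C -> C} := HB.pack h H.
apply: (@bounded_linear_continuous _ _ _ hl); apply/linear_boundedP.
near=> r => x; rewrite (le_trans (hb x))// ler_wpM2r//.
by near: r; apply: nbhs_pinfty_ge; rewrite normr_real.
Unshelve. all: by end_near. Qed.

Lemma bmulr_continuous a : continuous (fun x => x *b a).
Proof.
apply: (@bmul_continuous _ a) => [k x y|x]; first by rewrite bmulDl bscaleAl.
by rewrite mulrC ler_norm_bmul.
Qed.

Lemma bmull_continuous a : continuous (fun x => a *b x).
Proof.
apply: (@bmul_continuous _ a) => [k x y|x]; first by rewrite bmulDr bscaleAr.
exact: ler_norm_bmul.
Qed.

Lemma dual_lact_subproof a f : (fun x => f (x *b a)) \in dual_pred.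
Proof.
apply/mem_set; split=> [k x y|x]; first by rewrite bmulDl -bscaleAl linearP.
exact: (continuous_comp (@bmulr_continuous a x) (@dual_continuous _ _ f _)).
Qed.

Lemma dual_ract_subproof f a : (fun x => f (a *b x)) \in dual_pred.
Proof.
apply/mem_set; split=> [k x y|x]; first by rewrite bmulDr -bscaleAr linearP.
exact: (continuous_comp (@bmull_continuous a x) (@dual_continuous _ _ f _)).
Qed.

Definition dual_lact a f : dual C := Dual (dual_lact_subproof a f).
Definition dual_ract f a : dual C := Dual (dual_ract_subproof f a).

End DualBimodule.

Definition derivation {R : realType} {C : banachAlgType R[i]}
    (D : {linear C -> dual C}) :=
  forall a b : C, D (a *b b) = dual_lact a (D b) + dual_ract (D a) b.

Definition inner {R : realType} {C : banachAlgType R[i]}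
    (D : {linear C -> dual C}) :=
  exists f : dual C, forall a : C, D a = dual_lact a f - dual_ract f a.

Definition weakly_amenable {R : realType} (C : banachAlgType R[i]) :=
  forall D : {linear C -> dual C}, continuous D -> derivation D -> inner D.

Section ClosedIdeal.
Context {K : numFieldType}.

Record closedIdeal (B : banachAlgType K) := ClosedIdeal {
  ideal_set :> set B;
  ideal_submod : submod_closed (mem ideal_set);
  ideal_bmull : forall b x : B, ideal_set x -> ideal_set (b *b x);
  ideal_bmulr : forall b x : B, ideal_set x -> ideal_set (x *b b);
  ideal_closed : closed ideal_set
}.

Definition ideal_pred (B : banachAlgType K) (A : closedIdeal B) : {pred B} :=
  mem (ideal_set A).

HB.instance Definition _ (B : banachAlgType K) (A : closedIdeal B) :=
  GRing.isSubmodClosed.Build K B (ideal_pred A) (ideal_submod A).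

Record idealType (B : banachAlgType K) (A : closedIdeal B) :=
  IdealElt { ideal_val :> B; _ : ideal_val \in ideal_pred A }.
Arguments ideal_val {B A} _.

Section IdealAlgebra.
Context {B : banachAlgType K} {A : closedIdeal B}.
Local Notation T := (idealType A).
Implicit Types x y z : T.

HB.instance Definition _ := [isSub for @ideal_val B A].
HB.instance Definition _ := [Choice of T by <:].
HB.instance Definition _ := [SubChoice_isSubLmodule of T by <:].

Lemma ideal_valP x : ideal_set A x.
Proof. by case: x => x /= /set_mem. Qed.

Let ideal_normD x y : `|ideal_val (x + y)| <= `|ideal_val x| + `|ideal_val y|.
Proof. exact: ler_normD. Qed.

Let ideal_normZ (k : K) x : `|ideal_val (k *: x)| = `|k| * `|ideal_val x|.
Proof. exact: normrZ. Qed.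

Let ideal_norm0_eq0 x : `|ideal_val x| = 0 -> x = 0.
Proof. by move=> /normr0_eq0 x0; apply/val_inj. Qed.

HB.instance Definition _ := Lmodule_isNormed.Build K T
  ideal_normD ideal_normZ ideal_norm0_eq0.

Lemma ideal_normE x : `|x| = `|ideal_val x|.
Proof. by []. Qed.

Let ideal_complete (F : set_system T) : ProperFilter F -> cauchy F -> cvg F.
Proof.
move=> FF Fc.
have Gc : cauchy (ideal_val @ F).
  apply/cauchy_ballP => e e0; have /cauchy_ballP/(_ e e0) := Fc.
  rewrite !near_simpl => -[[P Q] /= [FP FQ] PQ].
  exists (ideal_val @` P, ideal_val @` Q) => /=.
    by split; [apply: filterS FP|apply: filterS FQ] => x Px; exists x.
  move=> [_ _] /= [[x Px <-] [y Qy <-]].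
  by have := PQ (x, y) (conj Px Qy); rewrite /= -!ball_normE.
have /cvg_ex[l Fl] : cvg (ideal_val @ F) by exact: cauchy_cvg.
have Al : ideal_set A l.
  apply: (closed_cvg (ideal_set A) (@ideal_closed B A) _ _ Fl).
  by apply: nearW => x; exact: ideal_valP.
apply/cvg_ex; exists (IdealElt (mem_set Al : l \in ideal_pred A)).
apply/fcvgrPdist_lt => e e0; have /cvgrPdist_lt/(_ e e0) := Fl.
by apply: filterS => x; rewrite ideal_normE.
Qed.

HB.instance Definition _ := Uniform_isComplete.Build T ideal_complete.

Lemma ideal_mul_subproof x y : ideal_val x *b ideal_val y \in ideal_pred A.
Proof. by apply/mem_set/ideal_bmull/ideal_valP. Qed.

Let ideal_mul x y : T := IdealElt (ideal_mul_subproof x y).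

Let ideal_mulA : associative ideal_mul.
Proof. by move=> x y z; apply/val_inj; exact: bmulA. Qed.

Let ideal_mulDl : left_distributive ideal_mul +%R.
Proof. by move=> x y z; apply/val_inj; exact: bmulDl. Qed.

Let ideal_mulDr : right_distributive ideal_mul +%R.
Proof. by move=> x y z; apply/val_inj; exact: bmulDr. Qed.

Let ideal_scaleAl (k : K) x y : k *: ideal_mul x y = ideal_mul (k *: x) y.
Proof. by apply/val_inj; exact: bscaleAl. Qed.

Let ideal_scaleAr (k : K) x y : k *: ideal_mul x y = ideal_mul x (k *: y).
Proof. by apply/val_inj; exact: bscaleAr. Qed.

Let ideal_norm_mul x y : `|ideal_mul x y| <= `|x| * `|y|.
Proof. exact: ler_norm_bmul. Qed.

HB.instance Definition _ := CompleteNormedModule_isBanachAlgebra.Build K T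
  ideal_mulA ideal_mulDl ideal_mulDr ideal_scaleAl ideal_scaleAr ideal_norm_mul.

Lemma ideal_val_bmul x y : ideal_val (x *b y) = ideal_val x *b ideal_val y.
Proof. by []. Qed.

End IdealAlgebra.
End ClosedIdeal.

Section ProjectiveTensorProduct.
Context {R : realType}.
Local Notation K := R[i].

(* A list of pairs stands for the formal sum of the a (x) b over its members.
   Two formal sums denote the same element of the algebraic tensor product iff
   they are identified by the monoid congruence generated by bilinearity;
   coefficients are absorbed in the first factor. *)
Inductive tensor_eq {A B : lmodType K} : seq (A * B) -> seq (A * B) -> Prop :=
| tensor_refl s : tensor_eq s s
| tensor_sym s1 s2 : tensor_eq s1 s2 -> tensor_eq s2 s1
| tensor_trans s1 s2 s3 :
    tensor_eq s1 s2 -> tensor_eq s2 s3 -> tensor_eq s1 s3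
| tensor_cat s1 s1' s2 s2' :
    tensor_eq s1 s1' -> tensor_eq s2 s2' -> tensor_eq (s1 ++ s2) (s1' ++ s2')
| tensor_catC s1 s2 : tensor_eq (s1 ++ s2) (s2 ++ s1)
| tensor_addl a1 a2 b : tensor_eq [:: (a1 + a2, b)] [:: (a1, b); (a2, b)]
| tensor_addr a b1 b2 : tensor_eq [:: (a, b1 + b2)] [:: (a, b1); (a, b2)]
| tensor_scale (k : K) a b : tensor_eq [:: (k *: a, b)] [:: (a, k *: b)]
| tensor_zero b : tensor_eq [:: (0, b)] [::].

Definition projective_norm {A B : normedModType K} (s : seq (A * B)) : R :=
  inf [set \sum_(p <- s') rnorm p.1 * rnorm p.2 | s' in tensor_eq s].

(* [T], with elementary tensors [t a b], is the projective tensor product of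
   [A] and [B], i.e. the completion of the algebraic tensor product for the
   projective norm, with its product; this determines [T] up to a unique
   isometric isomorphism compatible with elementary tensors. *)
Record is_projective_tensor (A B T : banachAlgType K) (t : A -> B -> T) : Prop := {
  tensor_linearl : forall b, linear (t^~ b);
  tensor_linearr : forall a, linear (t a);
  tensor_norm : forall s : seq (A * B),
    `|\sum_(p <- s) t p.1 p.2| = (projective_norm s)%:C;
  tensor_dense :
    closure [set \sum_(p <- s) t p.1 p.2 | s in [set: seq (A * B)]] = [set: T];
  tensor_bmul : forall a b c d, t a b *b t c d = t (a *b c) (b *b d)
}.

End ProjectiveTensorProduct.

(* Main.v *)
(** Write m : A (x) B -> A for the homomorphism a (x) b |-> ab. A continuous
    derivation D of A pulls back to the derivation u |-> D (m u) o m of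
    A (x) B, which vanishes on elementary tensors because A (x) B is
    commutative and weakly amenable; hence D (ab) (cd) = 0. It remains to see
    that a functional f on A killing all products is zero. For g in the dual
    of B, F = f (x) g kills all products of A (x) B, so u |-> F u *: F is a
    derivation and therefore zero, giving f a * g b = 0. If a <> 0, the
    Hahn-Banach theorem gives g with g a <> 0, whence f a = 0. Applying this
    first to D (ab) and then to x |-> D x c yields D = 0. *)

From HB Require Import structures.
Require Import Defs.
From mathcomp Require Import all_boot all_order all_algebra.
From mathcomp Require Import complex.
From mathcomp Require Import all_classical all_reals topology normedtype.

Set Implicit Arguments.
Unset Strict Implicit.
Unset Printing Implicit Defensive.

Import Order.TTheory GRing.Theory Num.Theory.
Import numFieldNormedType.Exports.

Local Open Scope classical_set_scope.
Local Open Scope ring_scope.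
Local Open Scope complex_scope.

(** * Hahn-Banach for sublinear functionals on a real vector space *)

Section HahnBanach.
Context {R : realType} {V : lmodType R}.
Implicit Types (p q : V -> R) (x y : V).

Definition sublinear p :=
  (forall x y, p (x + y) <= p x + p y) /\
  (forall (r : R) x, 0 <= r -> p (r *: x) <= r * p x).

Lemma sublinear0 p : sublinear p -> p 0 = 0.
Proof.
move=> [pD pZ]; apply/eqP; rewrite eq_le; apply/andP; split.
  by have := pZ 0 0 (lexx 0); rewrite scale0r mul0r.
by rewrite -(lerD2l (p 0)) addr0 -{1}(addr0 0) pD.
Qed.

Lemma sublinearZ p (r : R) x : sublinear p -> 0 <= r -> p (r *: x) = r * p x.
Proof.
move=> pS; have [pD pZ] := pS; rewrite le_eqVlt => /predU1P[<-|r0].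
  by rewrite scale0r mul0r sublinear0.
apply/eqP; rewrite eq_le (pZ _ _ (ltW r0)) -ler_pdivlMl//.
by rewrite -{1}(scalerK (lt0r_neq0 r0) x) pZ// invr_ge0 ltW.
Qed.

Lemma sublinearN p x : sublinear p -> - p (- x) <= p x.
Proof.
by move=> pS; rewrite lerNl -subr_ge0 opprK -(sublinear0 pS) -{1}(addNr x) pS.1.
Qed.

(** Common to infima of chains and to [sublinear_lower]: both are pointwise infima of families whose
    members combine only up to an inequality. *)
Lemma sublinear_inf (S : V -> set R) :
  (forall x, has_inf (S x)) ->
  (forall x y a b, S x a -> S y b -> exists2 c, S (x + y) c & c <= a + b) ->
  (forall (r : R) x a, 0 <= r -> S x a -> exists2 c, S (r *: x) c & c <= r * a) ->
  sublinear (inf \o S).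
Proof.
move=> infS SD SZ.
have infle x a : S x a -> inf (S x) <= a by apply: ge_inf; exact: (infS x).2.
split=> [x y|r x r0] /=.
  rewrite -lerBlDr; apply: lb_le_inf => [|a Sa]; first exact: (infS x).1.
  rewrite lerBlDl -lerBlDr; apply: lb_le_inf => [|b Sb]; first exact: (infS y).1.
  have [c /infle Sc cab] := SD _ _ _ _ Sa Sb.
  by rewrite lerBlDr (le_trans Sc)// addrC.
move: r0; rewrite le_eqVlt => /predU1P[r0|r0].
  have [[a Sa] _] := infS x.
  have [c /infle Sc] := SZ 0 x a (lexx _) Sa.
  by rewrite -r0 !mul0r; exact: le_trans.
rewrite -ler_pdivrMl//; apply: lb_le_inf => [|a Sa]; first exact: (infS x).1.
have [c /infle Sc ca] := SZ r x a (ltW r0) Sa.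
by rewrite ler_pdivrMl// (le_trans Sc).
Qed.

(** By Zorn's lemma. The pointwise infimum bounds a nonempty chain; it is finite because each member
    q satisfies q x >= - q (- x) >= - p (- x). *)
Lemma minimal_sublinear p : sublinear p ->
  exists m, [/\ sublinear m, forall x, m x <= p x &
    forall q, sublinear q -> (forall x, q x <= m x) -> q = m].
Proof.
move=> pS; pose T := {q | sublinear q /\ forall x, q x <= p x}.
(* The order is reversed, so that maximal elements for Zorn's lemma are minimal functionals. *)
pose le (s t : T) := `[< forall x, sval t x <= sval s x >].
have [|r s t /asboolP rs /asboolP st||A Atot|[m [mS mp]] mmin] := @Zorn T le.
- by move=> t; exact/asboolP.
- by apply/asboolP => x; exact: le_trans (st x) (rs x).
- move=> s t /asboolP st /asboolP ts.
  apply: eq_sig_hprop => [q ? ?|]; first exact: Prop_irrelevance.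
  apply/funext => x.
  by apply/eqP; rewrite eq_le ts st.
- have [A0|/set0P[s0 As0]] := eqVneq A set0.
    by exists (exist _ p (conj pS (fun x => lexx _))) => s; rewrite A0.
  pose S x := [set sval s x | s in A].
  have infS x : has_inf (S x).
    split; first by exists (sval s0 x), s0.
    exists (- p (- x)) => _ [[s [sS sp]] _ <-] /=.
    by rewrite (le_trans _ (sublinearN x sS))// lerN2.
  have iS : sublinear (inf \o S).
    apply: sublinear_inf => // [x y _ _ [s As <-] [t At <-]|r x _ r0 [s As <-]].
      have [/asboolP st|/asboolP ts] := Atot _ _ As At.
        exists (sval t (x + y)); first by exists t.
        by rewrite (le_trans ((svalP t).1.1 x y))// lerD.
      exists (sval s (x + y)); first by exists s.
      by rewrite (le_trans ((svalP s).1.1 x y))// lerD.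
    exists (sval s (r *: x)); first by exists s.
    exact: (svalP s).1.2.
  have ile s x : A s -> inf (S x) <= sval s x.
    by move=> As; apply: ge_inf; [exact: (infS x).2|exists s].
  have ip x : inf (S x) <= p x by exact: le_trans (ile _ _ As0) ((svalP s0).2 x).
  exists (exist _ (inf \o S) (conj iS ip)) => s As.
  by apply/asboolP => x; exact: ile.
- exists m; split=> // q qS qm.
  have qp x : q x <= p x by exact: le_trans (qm x) (mp x).
  by have := mmin (exist _ q (conj qS qp)) => /(_ (asboolT qm)) [].
Qed.

(* The largest sublinear functional below [p] whose value at [- y] is at most
   [- p y]. *)
Definition sublinear_lower p y x : R :=
  inf [set p (x + t *: y) - t * p y | t in [set t | 0 <= t]].

Lemma sublinear_lowerP p y : sublinear p ->
  sublinear (sublinear_lower p y) /\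
  (forall t x, 0 <= t -> sublinear_lower p y x <= p (x + t *: y) - t * p y).
Proof.
move=> pS; pose S x := [set p (x + t *: y) - t * p y | t in [set t | 0 <= t]].
have infS x : has_inf (S x).
  split; first by exists (p (x + 0 *: y) - 0 * p y), 0 => //=.
  (* Indeed t p y = p (t y) <= p (x + t y) + p (- x). *)
  exists (- p (- x)) => _ [t /= t0 <-].
  rewrite lerBrDl -(sublinearZ _ pS t0) lerBlDr (le_trans _ (pS.1 _ _))//.
  by rewrite addrAC subrr add0r.
split; last by move=> t x t0; apply: ge_inf; [exact: (infS x).2|exists t].
apply: (sublinear_inf infS) => [x x' _ _ [t /= t0 <-] [u /= u0 <-]|].
  exists (p (x + x' + (t + u) *: y) - (t + u) * p y).
    by exists (t + u) => //=; rewrite addr_ge0.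
  by rewrite scalerDl addrACA mulrDl opprD [leRHS]addrACA lerD2r pS.1.
move=> r x _ r0 [t /= t0 <-].
exists (p (r *: x + (r * t) *: y) - (r * t) * p y).
  by exists (r * t) => //=; rewrite mulr_ge0.
by rewrite -scalerA -scalerDr mulrBr mulrA lerD2r pS.2.
Qed.

(* A minimal sublinear functional [m] equals each [sublinear_lower m y], which
   forces it to be additive. *)
Lemma hahn_banach p x0 : sublinear p ->
  exists f : {linear V -> R^o}, (forall x, f x <= p x) /\ f x0 = p x0.
Proof.
(* Minimizing below [sublinear_lower p x0] instead of [p] forces m (- x0) <= - p x0, which yields
   the equality at [x0]. *)
move=> pS; have [qS qle] := sublinear_lowerP x0 pS.
have [m [mS mq mmin]] := minimal_sublinear qS.
have mp x : m x <= p x.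
  apply: (le_trans (mq x)); have := qle 0 x (lexx 0).
  by rewrite scale0r mul0r addr0 subr0.
have mD x y : m (x + y) = m x + m y.
  apply/eqP; rewrite eq_le mS.1 -lerBrDr/=.
  have [lS lle] := sublinear_lowerP y mS.
  have lm : sublinear_lower m y = m.
    apply: mmin => // z; have := lle 0 z (lexx 0).
    by rewrite scale0r mul0r addr0 subr0.
  by have := lle 1 x ler01; rewrite lm scale1r mul1r.
have mN x : m (- x) = - m x.
  by apply/eqP; rewrite -addr_eq0 -mD addNr sublinear0.
have mZ (r : R) x : m (r *: x) = r * m x.
  have [r0|r0] := leP 0 r; first exact: sublinearZ.
  by rewrite -[r]opprK scaleNr mN sublinearZ ?oppr_ge0 ?ltW// -mulNr.
have ml : linear (m : V -> R^o) by move=> r x y; rewrite mD mZ.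
pose mL := GRing.isLinear.Build R V R^o *:%R m ml.
pose f : {linear V -> R^o} := HB.pack m mL.
exists f; split=> //=.
apply/eqP; rewrite eq_le mp /= -lerN2 -mN.
apply: (le_trans (mq (- x0))); have := qle 1 (- x0) ler01.
by rewrite scale1r mul1r addNr sublinear0// sub0r.
Qed.

End HahnBanach.

(** * Complex spaces as real spaces *)

Section RealRestriction.
Context {R : realType}.

(** A separate name for the same type keeps the real scalar action apart from the complex one. *)
Definition realify (V : lmodType R[i]) : Type := V.

Section Instances.
Context {V : lmodType R[i]}.

HB.instance Definition _ := GRing.Zmodule.on (realify V).

Let realify_scale (r : R) (x : realify V) : realify V := r%:C *: (x : V).

Let realify_scaleA (r s : R) x :
  realify_scale r (realify_scale s x) = realify_scale (r * s) x.
Proof. by rewrite /realify_scale scalerA -rmorphM. Qed.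

Let realify_scale1 : left_id 1 realify_scale.
Proof. exact: scale1r. Qed.

Let realify_scaleDr : right_distributive realify_scale +%R.
Proof. by move=> r x y; exact: scalerDr. Qed.

Let realify_scaleDl x : {morph realify_scale^~ x : r s / r + s}.
Proof. by move=> r s; rewrite /realify_scale rmorphD scalerDl. Qed.

HB.instance Definition _ := GRing.Zmodule_isLmodule.Build R (realify V)
  realify_scaleA realify_scale1 realify_scaleDr realify_scaleDl.

Lemma realify_scaleE (r : R) (x : realify V) : r *: x = r%:C *: (x : V) :> V.
Proof. by []. Qed.

End Instances.
End RealRestriction.

(** * Bounded and continuous linear maps *)

Section BoundedLinear.
Context {R : realType} {V W : normedModType R[i]}.

Lemma bounded_continuous (f : {linear V -> W}) (M : R) :
  (forall x, rnorm (f x) <= M * rnorm x) -> continuous f.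
Proof.
move=> fM; apply: bounded_linear_continuous; apply/linear_boundedP.
near=> r => x.
have Mr : M%:C <= r.
  by near: r; apply: nbhs_pinfty_ge; rewrite complex_real.
rewrite (le_trans _ (ler_wpM2r (normr_ge0 x) Mr))//.
by rewrite !rnormE -rmorphM lecR.
Unshelve. all: by end_near. Qed.

Lemma continuous_bounded (f : {linear V -> W}) : continuous f ->
  exists2 M : R, 0 <= M & forall x, rnorm (f x) <= M * rnorm x.
Proof.
move=> /linear_bounded_continuous/linear_boundedP/pinfty_ex_gt0[M M0 fM].
have MC := RRe_real (gtr0_real M0).
exists (complex.Re M); first by rewrite -lecR MC ltW.
by move=> x; have := fM x; rewrite !rnormE -MC -rmorphM lecR.
Qed.

Lemma rnormN (x : V) : rnorm (- x) = rnorm x.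
Proof. by rewrite /rnorm normrN. Qed.

Lemma rnormZc (k : R[i]) (x : V) : rnorm (k *: x) = rnorm (k : R[i]^o) * rnorm x.
Proof.
apply: (@complexI R); rewrite -rnormE rmorphM normrZ -[X in _ = _ * X]rnormE.
by congr (_ * _); exact: (rnormE (k : R[i]^o)).
Qed.

Lemma rnormBC (x y : V) : rnorm (x - y) = rnorm (y - x).
Proof. by rewrite -rnormN opprB. Qed.

Lemma ler_rnormB_trans (z x y : V) : rnorm (x - y) <= rnorm (x - z) + rnorm (z - y).
Proof. by rewrite (le_trans _ (ler_rnormD _ _))// addrA subrK. Qed.

End BoundedLinear.

(** * Separation of points by continuous functionals *)

Section SeparatingDual.
Context {R : realType} {V : normedModType R[i]}.

Lemma dual_intro (f : V -> R[i]^o) (M : R) : linear f ->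
  (forall x, rnorm (f x) <= M * rnorm x) -> exists g : dual V, g =1 f.
Proof.
move=> fl fM; pose fL := GRing.isLinear.Build R[i] V R[i]^o *:%R f fl.
pose f' : {linear V -> R[i]^o} := HB.pack f fL.
have fc : continuous f by exact: (@bounded_continuous _ _ _ f' M).
by exists (Dual (mem_set (conj fl fc) : f \in dual_pred)).
Qed.

(** Hahn-Banach for the norm on the underlying real space; domination at x and at - x gives the
    bound on the absolute value. *)
Lemma real_norming (x0 : V) : exists u : V -> R,
  [/\ {morph u : x y / x + y}, forall (r : R) x, u (r%:C *: x) = r * u x,
      forall x, `|u x| <= rnorm x & u x0 = rnorm x0].
Proof.
pose p (x : realify V) := rnorm (x : V).
have pS : sublinear p.
  split=> [x y|r x r0]; first exact: ler_rnormD.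
  by rewrite /p realify_scaleE rnormZ ger0_norm.
have [u [up ux]] := hahn_banach (x0 : realify V) pS.
exists u; split=> //.
- by move=> x y; exact: (linearD u).
- by move=> r x; exact: (linearZ_LR u r).
- by move=> x; rewrite ler_norml up lerNl -linearN (le_trans (up _))// /p rnormN.
Qed.

Lemma dual_separates (x0 : V) : x0 != 0 -> exists g : dual V, g x0 != 0.
Proof.
move=> x00; have [u [uD uZ un ux]] := real_norming x0.
have uN x : u (- x) = - u x.
  by have := uZ (- 1) x; rewrite rmorphN rmorph1 scaleN1r mulN1r.
(* The complex functional u x - i u (i x) with real part [u]. *)
pose g (x : V) : R[i]^o := (u x +i* - u ('i *: x)).
have gl : linear g.
  move=> [a b] x y; rewrite /g.
  have uC (c d : R) z : u ((c +i* d) *: z) = c * u z + d * u ('i *: z).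
    rewrite -!uZ -uD scalerA -scalerDl.
    by congr (u (_ *: _)); simpc.
  rewrite scalerDr scalerA.
  have -> : 'i * (a +i* b) = (- b) +i* a :> R[i] by simpc.
  rewrite !uD (uC a b) (uC (- b) a); apply/eqP; rewrite eq_complex /=.
  apply/andP; split; apply/eqP.
    by rewrite mulrN opprK.
  by rewrite !opprD mulrN mulNr opprK [- _ + _]addrC addrC.
(* The bound 2 adds those of u x and u (i x), each at most the norm of x. *)
have [|f fg] := @dual_intro g 2 gl.
  move=> x; have -> : g x = (u x)%:C + - ('i * (u ('i *: x))%:C) :> R[i]^o.
    by rewrite /g; simpc.
  have nC (r : R) : rnorm (r%:C : R[i]^o) = `|r|.
    by rewrite /rnorm normc_def /= expr0n addr0 sqrtr_sqr.
  have ni : rnorm ('i : R[i]^o) = 1.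
    by rewrite /rnorm normc_def /= expr0n add0r expr1n sqrtr1.
  rewrite (le_trans (ler_rnormD _ _))// rnormN rnormM !nC ni mul1r mulr2n mulrDl.
  rewrite mul1r lerD// (le_trans (un _))// /rnorm normrZ.
  by rewrite normc_def /= expr0n add0r expr1n sqrtr1 mul1r.
exists f; rewrite fg /g eq_complex /= ux rnorm_eq0.
by rewrite (negPf x00).
Qed.

End SeparatingDual.

(** * Bilinear maps evaluated on formal sums of tensors *)

Section TensorExtension.
Context {R : realType} {A B T : banachAlgType R[i]}.
Variable t : A -> B -> T.
Hypothesis tT : is_projective_tensor t.

Definition tensor_sum {V : lmodType R[i]} (f : A -> B -> V) (s : seq (A * B)) : V :=
  \sum_(p <- s) f p.1 p.2.

Lemma tensor_sum_cat {V : lmodType R[i]} (f : A -> B -> V) s s' :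
  tensor_sum f (s ++ s') = tensor_sum f s + tensor_sum f s'.
Proof. exact: big_cat. Qed.

(** Formal sums carry no coefficients, so a scalar goes into the first factors; k = -1 gives
    differences of formal sums. *)
Lemma tensor_sumZ {V : lmodType R[i]} (f : A -> B -> V) k s :
  (forall b, linear (f^~ b)) ->
  tensor_sum f [seq (k *: p.1, p.2) | p <- s] = k *: tensor_sum f s.
Proof.
move=> fl; rewrite /tensor_sum big_map scaler_sumr; apply: eq_bigr => -[a b] _ /=.
have f0 : f 0 b = 0 by have := fl b (-1) 0 0; rewrite scaleN1r addNr scaleN1r addNr.
by have := fl b k a 0; rewrite addr0 f0 addr0.
Qed.

Lemma tensor_dist (u : T) (e : R) : 0 < e ->
  exists s, rnorm (u - tensor_sum t s) < e.
Proof.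
move=> e0; have : closure (range (tensor_sum t)) u by rewrite [X in X u](tensor_dense tT).
move=> /(_ _ (nbhsx_ballx u e%:C _)) [|_ [[s _ <-]]]; first by rewrite ltcR.
by rewrite -ball_normE /= rnormE ltcR => us; exists s.
Qed.

(** Both maps agree on finite sums of elementary tensors, which are dense. *)
Lemma tensor_ext {W : normedModType R[i]} (h1 h2 : {linear T -> W}) :
  continuous h1 -> continuous h2 -> (forall a b, h1 (t a b) = h2 (t a b)) ->
  h1 =1 h2.
Proof.
move=> /continuous_bounded[M1 M10 hM1] /continuous_bounded[M2 M20 hM2] h12 u.
apply/eqP; rewrite -subr_eq0 -rnorm_eq0 eq_le rnorm_ge0 andbT.
apply/ler_addgt0Pr => e e0; rewrite add0r.
(* Adding 1 keeps the divisor positive when both bounds are 0. *)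
have M0 : 0 < M1 + M2 + 1 by rewrite ltr_wpDl// addr_ge0.
have [s us] := tensor_dist u (divr_gt0 e0 M0).
have hs : h1 (tensor_sum t s) = h2 (tensor_sum t s).
  by rewrite /tensor_sum !linear_sum; apply: eq_bigr => p _.
rewrite (le_trans (ler_rnormB_trans (h1 (tensor_sum t s)) _ _))//.
rewrite -linearB hs -linearB.
rewrite (le_trans (lerD (hM1 _) (hM2 _)))// (rnormBC _ u) -mulrDl.
rewrite (@le_trans _ _ ((M1 + M2 + 1) * rnorm (u - tensor_sum t s)))//.
  by rewrite ler_wpM2r ?rnorm_ge0// lerDl.
by rewrite mulrC -ler_pdivlMr// ltW.
Qed.

Section Extension.
Context {E : completeNormedModType R[i]}.
Variables (f : A -> B -> E) (M : R).
Hypotheses (fl : forall b, linear (f^~ b)) (fr : forall a, linear (f a)).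
Hypothesis fM : forall a b, rnorm (f a b) <= M * (rnorm a * rnorm b).

Let linear_lin (V W : lmodType R[i]) (h : V -> W) : linear h ->
  [/\ {morph h : x y / x + y}, forall k x, h (k *: x) = k *: h x & h 0 = 0].
Proof.
move=> hl; pose hL := GRing.isLinear.Build R[i] V W *:%R h hl.
pose h' : {linear V -> W} := HB.pack h hL.
split=> [x y|k x|]; first exact: (linearD h').
  exact: (linearZ_LR h').
exact: (linear0 h').
Qed.

(** By bilinearity of [f] on each generator of the congruence, so [f] is well defined on the
    algebraic tensor product. *)
Lemma tensor_sum_eq s s' : tensor_eq s s' -> tensor_sum f s = tensor_sum f s'.
Proof.
have fE := (fun b => linear_lin (fl b), fun a => linear_lin (fr a)).
elim=> //= {s s'}.
- by move=> s1 s2 s3 _ -> _ ->.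
- by move=> s1 s1' s2 s2' _ e1 _ e2; rewrite !tensor_sum_cat e1 e2.
- by move=> s1 s2; rewrite !tensor_sum_cat addrC.
- by move=> a1 a2 b; rewrite /tensor_sum !big_cons !big_nil !addr0; have [->] := fE.1 b.
- by move=> a b1 b2; rewrite /tensor_sum !big_cons !big_nil !addr0; have [->] := fE.2 a.
- move=> k a b; rewrite /tensor_sum !big_cons !big_nil !addr0 /=.
  by have [_ -> _] := fE.1 b; have [_ -> _] := fE.2 a.
- by move=> b; rewrite /tensor_sum big_cons big_nil addr0; have [_ _] := fE.1 b.
Qed.

(** Every representative of the tensor has the same image, so the bound for one representative
    passes to the infimum, which is the norm in [T]. *)
Lemma tensor_sum_bound s : 0 <= M ->
  rnorm (tensor_sum f s) <= M * rnorm (tensor_sum t s).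
Proof.
move=> M0; pose S := [set \sum_(p <- s') rnorm p.1 * rnorm p.2 | s' in tensor_eq s].
have -> : rnorm (tensor_sum t s) = inf S.
  by rewrite /rnorm [X in complex.Re X](tensor_norm tT).
have fS a : S a -> rnorm (tensor_sum f s) <= M * a.
  move=> [s' /tensor_sum_eq -> <-]; rewrite mulr_sumr /tensor_sum.
  elim/big_ind2 : _ => [|x a' y b' xa yb|p _]; first by rewrite rnorm0.
    by rewrite (le_trans (ler_rnormD _ _))// lerD.
  exact: fM.
have S0 : S !=set0.
  exists (\sum_(p <- s) rnorm p.1 * rnorm p.2), s => //; exact: tensor_refl.
move: M0; rewrite le_eqVlt => /predU1P[M0|M0].
  by have [a /fS] := S0; rewrite -M0 !mul0r.
rewrite -ler_pdivrMl//; apply: lb_le_inf => // a /fS.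
by rewrite ler_pdivrMl.
Qed.
End Extension.
End TensorExtension.

(** * Universal property of the projective tensor product *)

Section TensorLift.
Context {R : realType} {A B T : banachAlgType R[i]} {E : completeNormedModType R[i]}.
Variable t : A -> B -> T.
Hypothesis tT : is_projective_tensor t.
Variables (f : A -> B -> E) (M : R).
Hypotheses (fl : forall b, linear (f^~ b)) (fr : forall a, linear (f a)).
Hypotheses (M0 : 0 <= M).
Hypothesis fM : forall a b, rnorm (f a b) <= M * (rnorm a * rnorm b).

Let tl := tensor_linearl tT.

Let sum_boundB s s' : rnorm (tensor_sum f s - tensor_sum f s') <=
  M * rnorm (tensor_sum t s - tensor_sum t s').
Proof.
have diffE (V : lmodType R[i]) (g : A -> B -> V) : (forall b, linear (g^~ b)) ->
    tensor_sum g s - tensor_sum g s' =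
    tensor_sum g (s ++ [seq (- 1 *: p.1, p.2) | p <- s']).
  by move=> gl; rewrite tensor_sum_cat tensor_sumZ// scaleN1r.
by rewrite !diffE//; exact: tensor_sum_bound.
Qed.

(** The value at [u] is the limit of the images of formal sums tending to [u]. The estimate for all
    [s] encodes linearity, boundedness and the values on elementary tensors. *)
Let lift_ex u : exists l : E, forall s,
  rnorm (l - tensor_sum f s) <= M * rnorm (u - tensor_sum t s).
Proof.
pose N (e : R) := [set tensor_sum f s | s in [set s | rnorm (u - tensor_sum t s) < e]].
pose F := filter_from [set e : R | 0 < e] N.
have M10 : 0 < M + 1 by rewrite ltr_wpDl.
have FF : ProperFilter F.
  apply: filter_from_proper => [|e /(tensor_dist tT u)[s us]]; last first.
    by exists (tensor_sum f s), s.
  apply: filter_from_filter; first by exists 1 => /=.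
  move=> e1 e2 /= e10 e20; exists (Num.min e1 e2) => /=; first by rewrite lt_min e10.
  by move=> _ [s /= + <-]; rewrite lt_min => /andP[s1 s2]; split; exists s.
have /cvg_ex[l Fl] : cvg F.
  apply: cauchy_cvg; apply/cauchy_ballP => e e0.
  have eC := RRe_real (gtr0_real e0).
  have {e0} e0 : 0 < complex.Re e by rewrite -ltcR eC.
  (* Two sums within d of [u] are at most 2 d apart, so their images are at most 2 M d apart, which
     is less than e. *)
  pose d := complex.Re e / (2 * (M + 1)).
  have d0 : 0 < d by rewrite divr_gt0// mulr_gt0.
  exists (N d, N d) => /=; first by split; exists d.
  move=> [_ _] /= [[s us <-] [s' us' <-]].
  rewrite -ball_normE /= rnormE -eC ltcR (le_lt_trans (sum_boundB _ _))//.
  have {us us'} ss : rnorm (tensor_sum t s - tensor_sum t s') <= 2 * d.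
    rewrite (le_trans (ler_rnormB_trans u _ _))// rnormBC mulr2n mulrDl !mul1r.
    by rewrite lerD// ltW.
  rewrite (le_lt_trans (ler_wpM2l M0 ss))//.
  have -> : complex.Re e = (M + 1) * (2 * d).
    by rewrite mulrA [RHS]mulrC [(M + 1) * 2]mulrC /d divfK// gt_eqF// mulr_gt0.
  by rewrite ltr_pM2r ?ltrDl// mulr_gt0.
exists l => s; apply/ler_addgt0Pr => e e0.
(* Pass through a sum s' within d of [u] whose image is within d of [l]: the excess is d + M d =
   e. *)
pose d := e / (M + 1); have d0 : 0 < d by rewrite divr_gt0.
have lF : F (ball l d%:C) by apply: Fl; apply: nbhsx_ballx; rewrite ltcR.
have NF : F (N d) by exists d.
have [z [ld [s' /= us' s'E]]] := filter_ex (filterI lF NF).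
move: ld; rewrite -s'E -ball_normE /= rnormE ltcR => ld.
rewrite (le_trans (ler_rnormB_trans (tensor_sum f s') _ _))//.
have -> : e = d + M * d.
  by rewrite -{1}[d]mul1r -mulrDl addrC [RHS]mulrC /d divfK ?gt_eqF.
rewrite addrCA lerD ?(ltW ld)// (le_trans (sum_boundB _ _))//.
rewrite -mulrDr ler_wpM2l// (le_trans (ler_rnormB_trans u _ _))//.
by rewrite addrC lerD2l rnormBC ltW.
Qed.

Lemma tensor_lift : exists2 m : {linear T -> E},
  continuous m & forall a b, m (t a b) = f a b.
Proof.
have [m mP] := choice lift_ex.
have ml : linear m.
  move=> k u v; apply/eqP; rewrite -subr_eq0 -rnorm_eq0 eq_le rnorm_ge0 andbT.
  apply/ler_addgt0Pr => e e0; rewrite add0r.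
  pose c := rnorm (k : R[i]^o).
  have c0 : 0 <= c by exact: rnorm_ge0.
  (* With [u] and [v] approximated within d, the sum [s2] is within (c + 1) d of k u + v. Comparing
     its image with m (k u + v) and with k m u + m v costs (M + 1) (c + 1) d each time. *)
  pose K := (c + 1) * (M + 1) * 2.
  have K0 : 0 < K by rewrite !mulr_gt0// ltr_wpDl.
  pose d := e / K; have d0 : 0 < d by rewrite divr_gt0.
  have [s /ltW us] := tensor_dist tT u d0; have [s' /ltW vs'] := tensor_dist tT v d0.
  pose s2 := [seq (k *: p.1, p.2) | p <- s] ++ s'.
  have s2E (V : lmodType R[i]) (g : A -> B -> V) : (forall b, linear (g^~ b)) ->
      tensor_sum g s2 = k *: tensor_sum g s + tensor_sum g s'.
    by move=> gl; rewrite tensor_sum_cat tensor_sumZ.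
  have comb (V : normedModType R[i]) (x x' y y' : V) a :
      rnorm (x - x') <= a -> rnorm (y - y') <= a ->
      rnorm ((k *: x + y) - (k *: x' + y')) <= (c + 1) * a.
    move=> xa ya; rewrite opprD addrACA -scalerBr (le_trans (ler_rnormD _ _))//.
    by rewrite rnormZc mulrDl mul1r lerD// ler_wpM2l.
  have {}mP w r a : rnorm (w - tensor_sum t r) <= a ->
      rnorm (m w - tensor_sum f r) <= (M + 1) * a.
    by move=> wr; rewrite (le_trans (mP w r))// ler_pM ?rnorm_ge0// lerDl.
  rewrite (le_trans (ler_rnormB_trans (tensor_sum f s2) _ _))//.
  have -> : e = (M + 1) * ((c + 1) * d) + (c + 1) * ((M + 1) * d).
    rewrite [(M + 1) * _]mulrCA -mulr2n -mulr_natr mulrA [RHS]mulrAC.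
    by rewrite [RHS]mulrC /d divfK// gt_eqF.
  rewrite lerD//; first by rewrite mP// s2E// comb.
  by rewrite rnormBC s2E// comb// mP.
pose mL := GRing.isLinear.Build R[i] T E *:%R m ml.
pose m' : {linear T -> E} := HB.pack m mL.
exists m'.
  apply: (@bounded_continuous _ _ _ m' M) => u.
  (* The empty formal sum gives the bound M. *)
  by have := mP u [::]; rewrite /tensor_sum !big_nil !subr0.
move=> a b; apply/eqP; rewrite -subr_eq0 -rnorm_eq0 eq_le rnorm_ge0 andbT.
by have := mP (t a b) [:: (a, b)]; rewrite /tensor_sum !big_seq1 /= subrr rnorm0 mulr0.
Qed.

End TensorLift.

(** * Adjoints and rank-one maps into the dual *)

Section DualMaps.
Context {R : realType} {V W : normedModType R[i]}.

Lemma rnorm_dual (f : dual V) : rnorm f = opnorm f.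
Proof. by []. Qed.

Section Comp.
Variables (m : {linear V -> W}) (mc : continuous m).

Lemma dual_comp_subproof (f : dual W) : (f \o m : V -> R[i]^o) \in dual_pred.
Proof.
apply/mem_set; split=> [k x y|x] /=; first by rewrite !linearP.
exact: continuous_comp (@mc x) (@dual_continuous _ _ f (m x)).
Qed.

(** The adjoint of [m]. *)
Definition dual_comp (f : dual W) : dual V := Dual (dual_comp_subproof f).

Lemma dual_comp_linear : linear dual_comp.
Proof. by move=> k f g; apply: dualP. Qed.

HB.instance Definition _ :=
  GRing.isLinear.Build R[i] (dual W) (dual V) *:%R dual_comp dual_comp_linear.

Lemma dual_comp_continuous : continuous dual_comp.
Proof.
have [M M0 mM] := continuous_bounded mc.
apply: (@bounded_continuous _ _ _ dual_comp M) => f.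
rewrite !rnorm_dual; apply: opnorm_le => [|x]; first by rewrite mulr_ge0 ?opnorm_ge0.
rewrite (le_trans (ler_opnorm f (m x)))// mulrAC [leRHS]mulrC.
by rewrite ler_wpM2l ?opnorm_ge0.
Qed.

End Comp.

Lemma dual_rank_one (F : dual V) : exists2 D : {linear V -> dual V},
  continuous D & forall x, D x = F x *: F.
Proof.
pose D x : dual V := F x *: F.
have Dl : linear D by move=> k x y; rewrite /D linearP scalerDl scalerA.
pose DL := GRing.isLinear.Build R[i] V (dual V) *:%R D Dl.
pose D' : {linear V -> dual V} := HB.pack D DL.
exists D' => //; apply: (@bounded_continuous _ _ _ D' (opnorm F * opnorm F)) => x.
by rewrite [D' x]/(F x *: F) rnormZc mulrAC ler_wpM2r ?opnorm_ge0// ler_opnorm.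
Qed.

End DualMaps.

(** * Multiplication operators and multiplicativity by density *)

Section Multiplication.
Context {R : realType} {C : banachAlgType R[i]}.

Definition bmull (a x : C) : C := a *b x.
Definition bmulr (a x : C) : C := x *b a.

Lemma bmull_linear a : linear (bmull a).
Proof. by move=> k x y; rewrite /bmull bmulDr bscaleAr. Qed.

Lemma bmulr_linear a : linear (bmulr a).
Proof. by move=> k x y; rewrite /bmulr bmulDl bscaleAl. Qed.

HB.instance Definition _ a :=
  GRing.isLinear.Build R[i] C C *:%R (bmull a) (bmull_linear a).
HB.instance Definition _ a :=
  GRing.isLinear.Build R[i] C C *:%R (bmulr a) (bmulr_linear a).

End Multiplication.

(** Density is used twice: in the left factor against a fixed elementary tensor, then in the right
    factor. *)
Lemma tensor_morph {R : realType} {A B T C : banachAlgType R[i]}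
    (t : A -> B -> T) (m : {linear T -> C}) :
  is_projective_tensor t -> continuous m ->
  (forall a b c d, m (t a b *b t c d) = m (t a b) *b m (t c d)) ->
  {morph m : u v / u *b v}.
Proof.
move=> tT mc mt.
have mr c d u : m (u *b t c d) = m u *b m (t c d).
  apply: (tensor_ext tT (h1 := m \o bmulr (t c d)) (h2 := bmulr (m (t c d)) \o m)).
  - by move=> x; apply: continuous_comp; [exact: bmulr_continuous|exact: mc].
  - by move=> x; apply: continuous_comp; [exact: mc|exact: bmulr_continuous].
  - by move=> a b; exact: mt.
move=> u v.
apply: (tensor_ext tT (h1 := m \o bmull u) (h2 := bmull (m u) \o m)).
- by move=> x; apply: continuous_comp; [exact: bmull_continuous|exact: mc].
- by move=> x; apply: continuous_comp; [exact: mc|exact: bmull_continuous].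
- by move=> c d; exact: mr.
Qed.

(** * Consequences of weak amenability of the tensor product *)

Section WeaklyAmenableTensor.
Context {R : realType} {A B T : banachAlgType R[i]}.
Variable t : A -> B -> T.
Hypothesis tT : is_projective_tensor t.
Hypothesis Acomm : commutative (@bmul R[i] A).
Hypothesis Bcomm : commutative (@bmul R[i] B).
Hypothesis Twa : weakly_amenable T.

Lemma tensor_dual_ext (F G : dual T) :
  (forall a b, F (t a b) = G (t a b)) -> F = G.
Proof.
move=> FG; apply: dualP; apply: (tensor_ext tT) => //; exact: dual_continuous.
Qed.

(** An inner derivation takes the value F (v u) - F (u v) at (u, v), and elementary tensors
    commute. *)
Lemma tensor_derivation0 (D : {linear T -> dual T}) a b c d :
  continuous D -> derivation D -> D (t a b) (t c d) = 0.
Proof.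
move=> Dc Dd; have [F DF] := Twa Dc Dd.
rewrite DF /= -[LHS]/(F (t c d *b t a b) - F (t a b *b t c d)).
by rewrite !(tensor_bmul tT) (Acomm a) (Bcomm b) subrr.
Qed.

(* For [F = f (x) g], which vanishes on products, [u |-> F u *: F] is a
   derivation. *)
Lemma square_annihilator_tensor (f : dual A) (g : dual B) a b :
  (forall x y, f (x *b y) = 0) -> f a * g b = 0.
Proof.
move=> f0.
(* The slice map sending x (x) y to g(y) x; following it by [f] gives f (x) g. *)
have [|x k y y'|||m mc mt] :=
    @tensor_lift R A B T A t tT (fun a b => g b *: a) (opnorm g).
- by move=> y k x x'; rewrite scalerDr !scalerA mulrC.
- by rewrite linearP scalerDl scalerA.
- exact: opnorm_ge0.
- by move=> x y; rewrite rnormZc [rnorm x * _]mulrC mulrA ler_wpM2r ?rnorm_ge0 ?ler_opnorm.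
pose F := dual_comp mc f.
have Ft x y : F (t x y) = g y * f x by rewrite /F /= mt linearZ.
(* By density in each factor in turn, it suffices to take elementary tensors, where f (x c) = 0 is a
   factor. *)
have F0 u v : F (u *b v) = 0.
  have -> : F (u *b v) = dual_ract F u v by [].
  have -> // : dual_ract F u = 0.
  apply: tensor_dual_ext => c d.
  have -> : dual_ract F u (t c d) = dual_lact (t c d) F u by [].
  have -> // : dual_lact (t c d) F = 0.
  apply: tensor_dual_ext => x y.
  by rewrite -[LHS]/(F (t x y *b t c d)) (tensor_bmul tT) Ft f0 mulr0.
have [D Dc DF] := dual_rank_one F.
have Dd : derivation D.
  move=> u v; rewrite !DF F0 scale0r; apply: dualP => x.
  rewrite -[RHS]/(F v * F (x *b u) + F u * F (v *b x)).
  by rewrite !F0 !mulr0 addr0.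
(* On the diagonal this says that the square of F (a (x) b) is 0. *)
have := tensor_derivation0 a b a b Dc Dd.
rewrite DF -[LHS]/(F (t a b) * F (t a b)) Ft mulrC => /eqP.
by rewrite mulf_eq0 orbb mulrC => /eqP.
Qed.

Lemma derivation_pullback_eq0 (m : {linear T -> A}) (D : {linear A -> dual A})
    a b c d :
  continuous m -> {morph m : u v / u *b v} -> continuous D -> derivation D ->
  D (m (t a b)) (m (t c d)) = 0.
Proof.
move=> mc mM Dc Dd; pose E : {linear T -> dual T} := dual_comp mc \o D \o m.
have Ec : continuous E.
  move=> u; apply: continuous_comp; first exact: mc.
  by apply: continuous_comp; [exact: Dc|exact: dual_comp_continuous].
have Ed : derivation E.
  move=> u v; apply: dualP => w; rewrite /E /= mM Dd.
  by rewrite -[RHS]/(D (m v) (m (w *b u)) + D (m u) (m (v *b w))) !mM.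
exact: (tensor_derivation0 a b c d Ec Ed).
Qed.

End WeaklyAmenableTensor.

(** * Closed ideals and the multiplication map *)

Section Ideal.
Context {R : realType} {B : banachAlgType R[i]} {A : closedIdeal B}.

Definition ideal_act (a : idealType A) (b : B) : idealType A :=
  IdealElt (mem_set (ideal_bmulr b (ideal_valP a)) : _ \in ideal_pred A).

Lemma ideal_mult_lift (T : banachAlgType R[i]) (t : idealType A -> B -> T) :
  is_projective_tensor t -> exists2 m : {linear T -> idealType A},
  continuous m & forall a b, m (t a b) = ideal_act a b.
Proof.
move=> tT; apply: (tensor_lift tT (M := 1)).
- by move=> b k x y; apply: val_inj; rewrite /= bmulDl -bscaleAl.
- by move=> a k x y; apply: val_inj; rewrite /= bmulDr -bscaleAr.
- exact: ler01.
- move=> a b; rewrite mul1r; have := ler_norm_bmul (ideal_val a) b.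
  by rewrite !rnormE -rmorphM lecR.
Qed.

Lemma square_annihilator_ideal (T : banachAlgType R[i])
    (t : idealType A -> B -> T) (f : dual (idealType A)) :
  is_projective_tensor t -> commutative (@bmul R[i] B) -> weakly_amenable T ->
  (forall x y, f (x *b y) = 0) -> f = 0.
Proof.
move=> tT Bcomm Twa f0; apply: dualP => a.
have Acomm : commutative (@bmul R[i] (idealType A)).
  by move=> x y; apply: val_inj; exact: Bcomm.
have [->|a0] := eqVneq a 0; first by rewrite linear0.
have [g ga] := @dual_separates R B (ideal_val a) a0.
(* The element a occupies both tensor factors, giving f a * g a = 0. *)
have /eqP := square_annihilator_tensor tT Acomm Bcomm Twa g a (ideal_val a) f0.
by rewrite mulf_eq0 (negPf ga) orbF => /eqP.
Qed.

End Ideal.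

Theorem theorem3p2 (R : realType) (B : banachAlgType R[i])
    (Bcomm : commutative (@bmul R[i] B)) (A : closedIdeal B)
    (AB : banachAlgType R[i]) (tens : idealType A -> B -> AB)
    (AB_tensor : is_projective_tensor tens) :
  weakly_amenable AB -> weakly_amenable (idealType A).
Proof.
move=> ABwa D Dc Dd.
have Acomm : commutative (@bmul R[i] (idealType A)).
  by move=> x y; apply: val_inj; exact: Bcomm.
have ann := square_annihilator_ideal AB_tensor Bcomm ABwa.
have [m mc mt] := ideal_mult_lift AB_tensor.
have mM : {morph m : u v / u *b v}.
  apply: (tensor_morph AB_tensor mc) => a b c d.
  rewrite (tensor_bmul AB_tensor) !mt; apply: val_inj => /=.
  (* This is (a c) (b d) = (a b) (c d). *)
  by rewrite !bmulA -(bmulA (ideal_val a)) (Bcomm (ideal_val c) b) bmulA.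
have Dprod a b : D (a *b b) = 0.
  apply: ann => c d.
  (* Every product in the ideal is the image under [m] of an elementary tensor, with the second
     element read in [B]. *)
  have mtv x y : m (tens x (ideal_val y)) = x *b y by rewrite mt; exact: val_inj.
  by rewrite -!mtv; exact: (derivation_pullback_eq0 AB_tensor).
have D0 a : D a = 0.
  have [M M0 DM] := continuous_bounded Dc.
  apply: dualP => c.
  (* For fixed c, the functional x |-> D x c kills products, so [ann] applies to it. *)
  have [|x|f fD] := @dual_intro _ _ (fun x => D x c) (M * rnorm c).
  - by move=> k x y; rewrite linearP.
  - rewrite (le_trans (ler_opnorm (D x) c))// mulrAC ler_wpM2r ?rnorm_ge0//.
    exact: DM.
  - by rewrite -[LHS]fD (ann f) // => x y; rewrite fD Dprod.
by exists 0 => a; rewrite D0; apply: dualP => x; rewrite -[RHS]/(0 - 0) subrr.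
Qed.
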